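(* Let $S$ be a compact Hausdorff space without isolated points and let $\varphi,\psi:S\to S$ be continuous maps with $\varphi\neq\psi$. Assume that the composition operators $C_\varphi$ and $C_\psi$ are Daugavet centers in $C(S)$. Then every weakly compact operator $T:C(S)\to C(S)$ satisfies $$\|tC_\varphi+(1-t)C_\psi+T\|=1+\|T\|$$ for all $t\in[0,1]$.
   Context: $C(S)$ is the Banach space of continuous functions $S\to\mathbb{C}$ with the supremum norm. The composition operator is $C_\varphi(f)=f\circ\varphi$ for $f\in C(S)$. A bounded linear operator $G:X\to X$ on a Banach space $X$ is a Daugavet center if $\|G+T\|=\|G\|+\|T\|$ for every rank-$1$ operator $T:X\to X$. Operators are bounded and linear. *)

(* Defs.v *)
From HB Require Import structures.
From mathcomp Require Import all_boot all_order all_algebra.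
From mathcomp Require Import all_classical all_reals all_analysis.
From mathcomp Require Import complex.

Set Implicit Arguments.
Unset Strict Implicit.
Unset Printing Implicit Defensive.

Import Order.TTheory GRing.Theory Num.Theory.
Import numFieldNormedType.Exports.

Local Open Scope classical_set_scope.
Local Open Scope ring_scope.
Local Open Scope complex_scope.

(* The norm of a normed space over [R[i]] takes its values in [R[i]]; [rnorm]
   is the same number seen in [R] (see [rnormE]). *)
Definition rnorm (R : realType) (X : normedModType R[i]) (x : X) : R :=
  complex.Re `|x|.

Section rnorm_theory.
Variables (R : realType) (X : normedModType R[i]).
Implicit Types x y : X.

Lemma rnormE x : (rnorm x)%:C = `|x|.
Proof. by rewrite /rnorm RRe_real// normr_real. Qed.

Lemma rnorm_ge0 x : 0 <= rnorm x.
Proof. by rewrite -ler0c rnormE. Qed.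

Lemma rnormD x y : rnorm (x + y) <= rnorm x + rnorm y.
Proof. by rewrite -lecR rmorphD/= !rnormE ler_normD. Qed.

Lemma rnormB x y : rnorm (x - y) = rnorm (y - x).
Proof. by rewrite /rnorm distrC. Qed.

Lemma rnormZ (a : R[i]) x : rnorm (a *: x) = rnorm (a : R[i]^o) * rnorm x.
Proof. by apply: complexI; rewrite rmorphM/= !rnormE normrZ. Qed.

Lemma rnorm_dist x y : `|rnorm x - rnorm y| <= rnorm (x - y).
Proof.
rewrite ler_norml; apply/andP; split.
  rewrite lerNl opprB lerBlDr rnormB.
  by have := rnormD (y - x) x; rewrite subrK.
rewrite lerBlDr.
by have := rnormD (x - y) y; rewrite subrK.
Qed.

Lemma rnorm_continuous : continuous (@rnorm R X).
Proof.
move=> x; apply/cvgrPdist_lt => e e0.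
have eC : 0 < e%:C by rewrite ltcR.
have : \forall y \near x, `|x - y| < e%:C.
  by have /cvgrPdist_lt/(_ _ eC) := @cvg_id _ (nbhs x).
apply: filterS => y; rewrite -rnormE ltcR; exact: le_lt_trans (rnorm_dist _ _).
Qed.

End rnorm_theory.

(* C(S). The proof of compactness is a parameter of the type, since the
   supremum norm is a norm only when continuous functions are bounded. *)
Definition Cspace (R : realType) (S : topologicalType)
    (cS : compact [set: S]) : Type :=
  continuousType S R[i]^o.

Section Cspace_lmodule.
Variables (R : realType) (S : topologicalType) (cS : compact [set: S]).
Let CS := Cspace R cS.
Implicit Types f g h : continuousType S R[i]^o.

HB.instance Definition _ := Choice.copy CS (continuousType S R[i]^o).

Lemma addf_continuous f g : continuous (fun x => f x + g x).
Proof. by move=> x; apply: cvgD; exact: cts_fun. Qed.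

Lemma oppf_continuous f : continuous (fun x => - f x).
Proof. by move=> x; apply: cvgN; exact: cts_fun. Qed.

Lemma scalef_continuous (a : R[i]) f : continuous (fun x => a *: f x).
Proof. by move=> x; apply: cvgZl_tmp; exact: cts_fun. Qed.

Let zeroC : CS := cst 0 : continuousType S R[i]^o.
Let oppC (f : CS) : CS := mkcts (@oppf_continuous f).
Let addC (f g : CS) : CS := mkcts (@addf_continuous f g).
Let scaleC (a : R[i]) (f : CS) : CS := mkcts (@scalef_continuous a f).

Let addCA : associative addC.
Proof. by move=> f g h; apply/continuousEP => x /=; exact: addrA. Qed.

Let addCC : commutative addC.
Proof. by move=> f g; apply/continuousEP => x /=; exact: addrC. Qed.

Let add0C : left_id zeroC addC.
Proof. by move=> f; apply/continuousEP => x /=; exact: add0r. Qed.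

Let addNC : left_inverse zeroC oppC addC.
Proof. by move=> f; apply/continuousEP => x /=; exact: addNr. Qed.

HB.instance Definition _ := GRing.isZmodule.Build CS addCA addCC add0C addNC.

Let scaleCA (a b : R[i]) (f : CS) : scaleC a (scaleC b f) = scaleC (a * b) f.
Proof. by apply/continuousEP => x /=; exact: scalerA. Qed.

Let scale1C : left_id 1 scaleC.
Proof. by move=> f; apply/continuousEP => x /=; exact: scale1r. Qed.

Let scaleCDr : right_distributive scaleC +%R.
Proof. by move=> a f g; apply/continuousEP => x /=; exact: scalerDr. Qed.

Let scaleCDl (f : CS) : {morph scaleC^~ f : a b / a + b}.
Proof. by move=> a b; apply/continuousEP => x /=; exact: scalerDl. Qed.

HB.instance Definition _ :=
  GRing.Zmodule_isLmodule.Build R[i] CS scaleCA scale1C scaleCDr scaleCDl.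

End Cspace_lmodule.

Section Cspace_norm.
Variables (R : realType) (S : topologicalType) (cS : compact [set: S]).
Local Notation CS := (Cspace R cS).
Implicit Types f g : CS.

Lemma CspaceP f g : (forall x, f x = g x) -> f = g.
Proof. by move=> fg; apply/continuousEP. Qed.

Lemma Cspace_addE f g x : (f + g) x = f x + g x. Proof. by []. Qed.
Lemma Cspace_oppE f x : (- f) x = - f x. Proof. by []. Qed.
Lemma Cspace_scaleE (a : R[i]) f x : (a *: f) x = a *: f x.
Proof. by []. Qed.

Definition supnorm f : R := sup (range (fun x => rnorm (f x))).

Lemma supnorm_ubound f : has_ubound (range (fun x => rnorm (f x))).
Proof.
have cf : {within [set: S], continuous (fun x => rnorm (f x))}.
  apply: continuous_subspaceT => x.
  by apply: continuous_comp; [exact: cts_fun|exact: rnorm_continuous].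
have /compact_bounded[M [_ MP]] := continuous_compact cf cS.
exists (M + 1) => _ [x _ <-]; apply: le_trans (ler_norm _) _.
by apply: (MP (M + 1)); [rewrite ltrDl|exists x].
Qed.

Lemma supnorm_ge f x : rnorm (f x) <= supnorm f.
Proof. by apply: ub_le_sup; [exact: supnorm_ubound|exists x]. Qed.

Lemma supnorm_le f (M : R) :
  0 <= M -> (forall x, rnorm (f x) <= M) -> supnorm f <= M.
Proof.
move=> M0 fM; rewrite /supnorm.
have [->|/set0P f0] := eqVneq (range (fun x => rnorm (f x))) set0.
  by rewrite sup0.
by apply: ge_sup => // _ [x _ <-].
Qed.

Lemma supnorm_ge0 f : 0 <= supnorm f.
Proof.
have [f0|/set0P[_ [x _ _]]] := eqVneq (range (fun x => rnorm (f x))) set0.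
  by rewrite /supnorm f0 sup0.
exact: le_trans (rnorm_ge0 (f x)) (supnorm_ge f x).
Qed.

Let supnormD f g : (supnorm (f + g))%:C <= (supnorm f)%:C + (supnorm g)%:C.
Proof.
rewrite -rmorphD/= lecR; apply: supnorm_le => [|x].
  by rewrite addr_ge0// supnorm_ge0.
by rewrite Cspace_addE; apply: le_trans (rnormD _ _) _; rewrite lerD// supnorm_ge.
Qed.

Let supnormZ_le (a : R[i]) f :
  supnorm (a *: f) <= rnorm (a : R[i]^o) * supnorm f.
Proof.
apply: supnorm_le => [|x]; first by rewrite mulr_ge0 ?rnorm_ge0 ?supnorm_ge0.
by rewrite Cspace_scaleE rnormZ ler_wpM2l ?rnorm_ge0 ?supnorm_ge.
Qed.

Let supnormZ (a : R[i]) f : (supnorm (a *: f))%:C = `|a| * (supnorm f)%:C.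
Proof.
have -> : `|a| = (rnorm (a : R[i]^o))%:C by rewrite rnormE.
rewrite -rmorphM/=; congr (_%:C).
have [->|a0] := eqVneq a 0.
  apply/eqP; rewrite eq_le supnormZ_le/=.
  rewrite [rnorm _](_ : _ = 0) ?mul0r ?supnorm_ge0//.
  by rewrite /rnorm normr0.
apply/eqP; rewrite eq_le supnormZ_le/=.
have rV : rnorm (a^-1 : R[i]^o) = (rnorm (a : R[i]^o))^-1.
  by apply: complexI; rewrite fmorphV/= !rnormE normfV.
have ra0 : 0 < rnorm (a : R[i]^o) by rewrite -ltcR rnormE normr_gt0.
have := supnormZ_le a^-1 (a *: f).
by rewrite scalerA mulVf// scale1r rV ler_pdivlMl.
Qed.

Let supnorm_eq0 f : (supnorm f)%:C = 0 -> f = 0.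
Proof.
move=> /complexI f0; apply: CspaceP => x; apply/eqP.
rewrite -[_ == _]normr_eq0 -rnormE eq_le ler0c rnorm_ge0 andbT lecR -f0.
exact: supnorm_ge.
Qed.

HB.instance Definition _ := Lmodule_isNormed.Build R[i] CS
  supnormD supnormZ supnorm_eq0.

Lemma rnorm_supnorm f : rnorm f = sup (range (fun x => rnorm (f x))).
Proof. by []. Qed.

End Cspace_norm.

Section complete.
Variable R : realType.

Lemma normC_le (z : R[i]) (r : R) :
  `|complex.Re z| <= r -> `|complex.Im z| <= r -> `|z| <= (r + r)%:C.
Proof.
case: z => a b /= ar br; rewrite [X in X <= _](_ : _ = `|a%:C + 'i%C * b%:C|).
  apply: le_trans (ler_normD _ _) _; rewrite normrM rmorphD/= lerD//.
    by rewrite normc_def/= expr0n addr0 sqrtr_sqr lecR.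
  rewrite !normc_def/= !expr0n/= expr1n add0r sqrtr1 addr0 sqrtr_sqr.
  by rewrite mul1r lecR.
by rewrite [in LHS](complexE (a +i* b)).
Qed.

Lemma cvg_complexP (F : set_system R[i]^o) (z : R[i]^o) : Filter F ->
  (fun w : R[i]^o => complex.Re w) @ F --> complex.Re z ->
  (fun w : R[i]^o => complex.Im w) @ F --> complex.Im z -> F --> z.
Proof.
move=> FF Fr Fi; apply/cvgrPdist_le => e e0.
have [r er] : exists r : R, e = r%:C.
  by apply/complex_realP; rewrite gtr0_real.
rewrite {}er in e0 *.
have r0 : 0 < r / 2 by rewrite divr_gt0// -ltcR.
near=> w; rewrite [r]splitr; apply: normC_le.
  rewrite raddfB/=; near: w.
  by move/cvgrPdist_le : Fr => /(_ _ r0).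
rewrite raddfB/=; near: w.
by move/cvgrPdist_le : Fi => /(_ _ r0).
Unshelve. all: by end_near. Qed.


Lemma complex_cauchy_cvg (F : set_system R[i]^o) :
  ProperFilter F -> cauchy F -> cvg F.
Proof.
move=> FF /cauchyP Fc.
have Fpart (g : R[i]^o -> R) : (forall z w, `|g z - g w|%:C <= `|z - w|) ->
    cvg (g @ F).
  move=> gle; apply: cauchy_cvg; apply/cauchyP => e e0.
  have eC : 0 < e%:C by rewrite ltcR.
  have [z Fz] := Fc _ eC; exists (g z).
  change (F (g @^-1` ball (g z) e)).
  apply: filterS Fz => w; rewrite /ball/= => zw.
  by rewrite -ltcR; apply: le_lt_trans zw; exact: gle.
have /Fpart cRe : forall z w : R[i]^o,
    `|complex.Re z - complex.Re w|%:C <= `|z - w|.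
  by move=> z w; rewrite -raddfB; exact: normc_ge_Re.
have /Fpart cIm : forall z w : R[i]^o,
    `|complex.Im z - complex.Im w|%:C <= `|z - w|.
  move=> z w; rewrite -raddfB; have := normc_ge_Re ((z - w) * 'i).
  rewrite ReiNIm normrN => /le_trans; apply.
  by rewrite normrM [`|'i|]normc_def/= expr0n expr1n add0r sqrtr1 mulr1.
apply: (@cvgP _ _ (lim ((fun w : R[i]^o => complex.Re w) @ F)
           +i* lim ((fun w : R[i]^o => complex.Im w) @ F) : R[i]^o)).
exact: cvg_complexP.
Qed.

Variables (S : topologicalType) (cS : compact [set: S]).

Lemma Cspace_cauchy_cvg (F : set_system (Cspace R cS)) :
  ProperFilter F -> cauchy F -> cvg F.
Proof.
move=> FF /cauchyP Fc.
have evle (f g : Cspace R cS) x : `|f x - g x| <= `|f - g|.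
  by rewrite -!rnormE lecR; exact: (supnorm_ge (f - g) x).
have Fx x : cvg ((fun f : Cspace R cS => f x : R[i]^o) @ F).
  apply: complex_cauchy_cvg; apply/cauchyP => e e0.
  have [f Ff] := Fc _ e0; exists (f x).
  change (F [set g | ball (f x : R[i]^o) e (g x)]); apply: filterS Ff => g fg.
  by apply: le_lt_trans fg; exact: evle.
pose h x := lim ((fun f : Cspace R cS => f x : R[i]^o) @ F).
have e3E (e : R[i]) : e = e / 3 + e / 3 + e / 3.
  rewrite -!mulrDl (_ : e + e + e = e * 3) ?mulfK ?pnatr_eq0//.
  by rewrite mulr_natr !mulrS mulr0n addr0 addrA.
have Fh (e : R[i]) : 0 < e ->
    \forall f \near F, forall x, `|(f : Cspace R cS) x - h x| <= e.
  move=> e0; have e30 : 0 < e / 3 by rewrite divr_gt0.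
  have [f Ff] := Fc _ e30; apply: filterS (Ff) => g fg x.
  have Fk : \forall k \near F, `|h x - (k : Cspace R cS) x| <= e / 3.
    by have /cvgrPdist_le/(_ _ e30) := Fx x.
  have [k [hk fk]] := filter_ex (filterI Fk Ff).
  rewrite (_ : g x - h x = (g x - f x) + (f x - k x) + (k x - h x)); last first.
    by rewrite !addrA !subrK.
  rewrite [e]e3E; apply: le_trans (ler_normD _ _) _; rewrite lerD//.
    apply: le_trans (ler_normD _ _) _; rewrite lerD//.
      by rewrite distrC; apply: le_trans (evle _ _ _) (ltW fg).
    by apply: le_trans (evle _ _ _) (ltW fk).
  by rewrite distrC.
have hc : continuous h.
  move=> x; apply/cvgrPdist_le => e e0.
  have e30 : 0 < e / 3 by rewrite divr_gt0.
  have [f fh] := filter_ex (Fh _ e30).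
  have : \forall y \near x, `|f x - f y| <= e / 3.
    by have /cvgrPdist_le/(_ _ e30) := @cts_fun _ _ f x.
  apply: filterS => y fxy.
  rewrite (_ : h x - h y = (h x - f x) + (f x - f y) + (f y - h y)); last first.
    by rewrite !addrA !subrK.
  rewrite [e]e3E; apply: le_trans (ler_normD _ _) _; rewrite lerD//.
  by apply: le_trans (ler_normD _ _) _; rewrite lerD// distrC.
apply: (@cvgP _ _ (mkcts hc : Cspace R cS)).
apply/cvgrPdist_le => e e0.
have [r er] : exists r : R, e = r%:C.
  by apply/complex_realP; rewrite gtr0_real.
rewrite {}er in e0 *.
apply: filterS (Fh _ e0) => f fh.
rewrite -rnormE lecR; apply: supnorm_le => [|x].
  by rewrite -ler0c ltW.
by rewrite -lecR rnormE distrC; exact: fh.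
Qed.

HB.instance Definition _ :=
  Uniform_isComplete.Build (Cspace R cS) Cspace_cauchy_cvg.

End complete.

Section operators.
Variables (R : realType) (X Y : completeNormedModType R[i]).

Definition closed_unit_ball : set X := [set x | `|x| <= 1].

Definition opnorm (T : X -> Y) : R :=
  sup [set rnorm (T x) | x in closed_unit_ball].

Definition bounded_op (T : {linear X -> Y}) :=
  exists M : R, forall x, rnorm (T x) <= M * rnorm x.

Definition rank_one (T : {linear X -> Y}) :=
  exists2 y : Y, y != 0 & range T = [set a *: y | a in [set: R[i]]].

End operators.

Arguments closed_unit_ball {R} X.

Section weak_topology.
Variables (R : realType) (X : completeNormedModType R[i]).

Definition topdual := {l : {linear X -> R[i]^o} | continuous l}.

(* [X] with its weak topology: the coarsest one making every element of the
   topological dual continuous. *)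
Definition weak : topologicalType :=
  sup_topology (fun l : topdual =>
    Topological.on (initial_topology (sval l : X -> R[i]^o))).

Lemma weak_cvgP (F : set_system X) (x : X) : Filter F ->
  F --> (x : weak) <-> forall l : topdual, sval l @ F --> sval l x.
Proof.
move=> FF; rewrite cvg_sup; split=> Fx l; have {}Fx := Fx l.
  have cl := @initial_continuous X R[i]^o (sval l : X -> R[i]^o) x.
  by apply: cvg_trans cl => A /= /Fx.
have /= Wx := @nbhsE (initial_topology (sval l : X -> R[i]^o)) x.
move=> A /=; rewrite Wx => -[_ [[B oB <-] Bx] BA].
by apply: filterS BA _; apply: Fx; exact: open_nbhs_nbhs.
Qed.

End weak_topology.

Definition weakly_compact (R : realType) (X Y : completeNormedModType R[i])
    (T : {linear X -> Y}) :=
  @precompact (weak Y) (T @` closed_unit_ball X).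

Definition daugavet_center (R : realType) (X : completeNormedModType R[i])
    (G : {linear X -> X}) :=
  bounded_op G /\
  forall T : {linear X -> X}, bounded_op T -> rank_one T ->
    opnorm (fun x => G x + T x) = opnorm G + opnorm T.

Section composition_operator.
Variables (R : realType) (S : topologicalType) (cS : compact [set: S]).
Variable phi : continuousType S S.

Definition comp_op (f : Cspace R cS) : Cspace R cS :=
  (f : continuousType S R[i]^o) \o phi : continuousType S R[i]^o.

Let comp_op_linear : linear comp_op.
Proof. by move=> a f g; exact: CspaceP. Qed.

HB.instance Definition _ :=
  GRing.isLinear.Build R[i] (Cspace R cS) (Cspace R cS) *:%R comp_op
    comp_op_linear.

End composition_operator.

Arguments comp_op R {S} cS phi f.

(* Main.v *)
(* The Daugavet property of [comp_op phi] forces every fibre of [phi] to have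
   empty interior: a rank-one perturbation cancels [comp_op phi] on an open set
   where [phi] is constant. On the other side, weak compactness of [T] gives,
   for every point p and e > 0, a neighbourhood W of p such that |T h| <= e for
   every h of norm <= 1 supported in W and vanishing near p; otherwise a gliding
   hump yields partial sums whose images violate the interchange of limits
   valid in a relatively weakly compact subset of C(S). Hence the open set where
   |T f| is almost maximal contains a point s such that T is almost insensitive
   to a change of f near phi(s) and psi(s); there f can be given, at phi(s) and
   psi(s), the phase of T f(s), so that both terms add up in modulus. *)
From HB Require Import structures.
Require Import Defs.
From mathcomp Require Import all_boot all_order all_algebra.
From mathcomp Require Import all_classical all_reals all_analysis.
From mathcomp Require Import complex ring lra.

Set Implicit Arguments.
Unset Strict Implicit.

Import Order.TTheory GRing.Theory Num.Theory.
Import numFieldNormedType.Exports.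
Local Open Scope classical_set_scope.
Local Open Scope ring_scope.
Local Open Scope complex_scope.
Local Notation modulus z := (rnorm (z : _[i]^o)).

(** * Moduli and phases of complex scalars *)

Section scalars.
Context {R : realType}.
Implicit Types z w : R[i].

Lemma modulusE z : (modulus z)%:C = `|z|.
Proof. exact: (rnormE (z : R[i]^o)). Qed.

Lemma modulus0 : modulus (0 : R[i]) = 0.
Proof. by rewrite /rnorm normr0. Qed.

Lemma modulus1 : modulus (1 : R[i]) = 1.
Proof. by rewrite /rnorm normr1. Qed.

Lemma modulusM z w : modulus (z * w) = modulus z * modulus w.
Proof. exact: (@rnormZ R R[i]^o z w). Qed.

Lemma modulus_real (x : R) : modulus x%:C = `|x|.
Proof. by apply: complexI; rewrite modulusE normc_def/= expr0n/= addr0 sqrtr_sqr. Qed.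

Lemma modulus_polar z : exists2 c, modulus c = 1 & z = (modulus z)%:C * c.
Proof.
have [->|z0] := eqVneq z 0; first by exists 1; rewrite ?modulus1 ?modulus0 ?mul0r.
exists (z / `|z|); last by rewrite modulusE mulrC divfK ?normr_eq0.
by apply: complexI; rewrite modulusE normrM normfV normr_id divff ?normr_eq0.
Qed.

(** Multiplying [w] by the quotient of the two phases puts it on the ray of [z], where moduli
    add. *)
Lemma modulus_align z w :
  exists2 c, modulus c = 1 & modulus (z + c * w) = modulus z + modulus w.
Proof.
have [a a1 za] := modulus_polar z; have [b b1 wb] := modulus_polar w.
have b0 : b != 0 by apply: contra_eqT b1 => /negPn/eqP->; rewrite modulus0 eq_sym oner_eq0.
have bV : modulus b^-1 = 1.
  by have := modulusM b b^-1; rewrite b1 mul1r divff// modulus1.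
exists (a / b); first by rewrite modulusM a1 bV mulr1.
rewrite {1}za {1}wb mulrACA [a * _]mulrC -mulrA mulVf// mulr1 -mulrDl -rmorphD/=.
by rewrite modulusM a1 mulr1 modulus_real ger0_norm// addr_ge0// rnorm_ge0.
Qed.

End scalars.

(** * The unit ball of C(S) and point evaluations *)

Section Cspace_unit_ball.
Context {R : realType} {S : topologicalType} {cS : compact [set: S]}.
Local Notation CS := (Cspace R cS).
Implicit Types (f g h : CS) (s p : S).

Lemma rnorm_eval_le f s : rnorm (f s) <= rnorm f.
Proof. exact: supnorm_ge. Qed.

Lemma Cspace_rnorm_le f (M : R) :
  0 <= M -> (forall s, rnorm (f s) <= M) -> rnorm f <= M.
Proof. exact: supnorm_le. Qed.

Lemma closed_unit_ballE f : closed_unit_ball CS f = (rnorm f <= 1).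
Proof. by rewrite /closed_unit_ball/= -rnormE -(lecR (rnorm f) 1). Qed.

Lemma nbhs_rnorm_lt f s (e : R) : 0 < e ->
  \forall s' \near s, rnorm (f s' - f s : R[i]^o) < e.
Proof.
move=> e0; have eC : 0 < e%:C by rewrite ltcR.
have /cvgrPdist_lt/(_ _ eC) := @cts_fun _ _ f s.
by apply: filterS => s'; rewrite -rnormE ltcR rnormB.
Qed.

Definition point_eval s f : R[i]^o := f s.

Lemma point_eval_linear s : linear (point_eval s).
Proof. by []. Qed.

HB.instance Definition _ s :=
  GRing.isLinear.Build R[i] CS R[i]^o *:%R (point_eval s) (point_eval_linear s).

Lemma point_eval_continuous s : continuous (point_eval s).
Proof.
move=> f; apply/(@cvgrPdist_le _ _ _ (nbhs f) (nbhs_filter f)) => e e0.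
apply: (@filterS _ _ (nbhs_filter f)) (nbhsx_ballx f e e0) => g.
rewrite -ball_normE => /ltW; apply: le_trans.
by rewrite -!rnormE lecR; exact: (rnorm_eval_le (f - g)).
Qed.

End Cspace_unit_ball.

(** * Cluster points and the interchange of limits *)

Section limits.
Context {R : realType} {S : topologicalType} {cS : compact [set: S]}.
Local Notation CS := (Cspace R cS).
Implicit Types (f g h : CS) (s p : S).

Lemma compact_sequence_cluster {X : topologicalType} {A : set X} {u : nat -> X} :
  compact A -> (forall n, A (u n)) ->
  exists x : X, forall V N, nbhs x V -> exists2 n, (N <= n)%N & V (u n).
Proof.
move=> cA uA.
have [|x [_ xu]] := cA (u @ \oo) _; first by exists 0%N => // n _; exact: uA.
exists x => V N xV.
have uN : (u @ \oo) (u @` [set n | (N <= n)%N]).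
  by exists N => // n Nn; exists n.
by have [_ [[n /= Nn <-] Vn]] := xu _ _ uN xV; exists n.
Qed.

(** Evaluations are continuous functionals, so a weak cluster point [y] of the images is a cluster
    point at every [s]. *)
Lemma weakly_compact_cluster (T : {linear CS -> CS}) (g : nat -> CS) :
  weakly_compact T -> (forall n, rnorm (g n) <= 1) ->
  exists y : CS, forall s (e : R) N, 0 < e ->
    exists2 n, (N <= n)%N & modulus (T (g n) s - y s) < e.
Proof.
rewrite /weakly_compact precompactE => cT g1.
have [n|y yP] := @compact_sequence_cluster (weak CS) _ (fun n => T (g n)) cT _.
  by apply: subset_closure; exists (g n) => //; rewrite closed_unit_ballE.
exists y => s e N e0; apply: (yP [set z : CS | modulus (z s - y s) < e]).
have /(weak_cvgP y (nbhs_filter (y : weak CS))) :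
  nbhs (y : weak CS) --> (y : weak CS) by exact: cvg_id.
move=> /(_ (exist _ (point_eval s : {linear _ -> _}) (@point_eval_continuous _ _ _ s))) /=.
move=> /cvgrPdist_lt/(_ e%:C); rewrite ltcR => /(_ e0).
by apply: filterS => z /=; rewrite -modulusE ltcR rnormB.
Qed.

(* Both bounds pass to a cluster point of [s] for a cluster point of [T \o g]. *)
Lemma weakly_compact_double_limit (T : {linear CS -> CS}) (g : nat -> CS)
    (s : nat -> S) (a b : R) :
  weakly_compact T -> (forall n, rnorm (g n) <= 1) ->
  (forall j n, (j <= n)%N -> b <= modulus (T (g n) (s j))) ->
  (forall j n, (n < j)%N -> modulus (T (g n) (s j)) <= a) -> b <= a.
Proof.
move=> wT g1 lower upper; apply/ler_addgt0Pr => e e0.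
have e4 : 0 < e / 4 by rewrite divr_gt0.
have [y yP] := weakly_compact_cluster wT g1.
have [x xP] := @compact_sequence_cluster S _ s cS (fun=> I).
have : modulus (y x) <= a + e / 2.
  (* Here [n] is fixed before [j > n], so [upper] applies; the second bound fixes [j] first and then
     [n >= j], so [lower] applies. *)
  have [n _ yn] := yP x _ 0%N e4.
  have [j nj xj] := xP _ n.+1 (nbhs_rnorm_lt (T (g n)) x e4).
  have := upper _ _ nj.
  have := rnorm_dist (T (g n) x : R[i]^o) (y x).
  have := rnorm_dist (T (g n) (s j) : R[i]^o) (T (g n) x).
  by move: yn xj => /=; rewrite !ler_norml => ? ? /andP[? ?] /andP[? ?]; lra.
have : b - e / 2 <= modulus (y x).
  have [j _ xj] := xP _ 0%N (nbhs_rnorm_lt y x e4).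
  have [n jn yn] := yP (s j) _ j e4.
  have := lower _ _ jn.
  have := rnorm_dist (T (g n) (s j) : R[i]^o) (y (s j)).
  have := rnorm_dist (y (s j) : R[i]^o) (y x).
  by move: yn xj => /=; rewrite !ler_norml => ? ? /andP[? ?] /andP[? ?]; lra.
by lra.
Qed.

End limits.

(** * Functions supported near a point and vanishing around it *)

Section bumps.
Context {R : realType} {S : topologicalType} {cS : compact [set: S]}.
Local Notation CS := (Cspace R cS).
Implicit Types (f g h : CS) (s p : S) (W : set S).

(** Vanishing near [p] leaves room for a further bump closer to [p] with disjoint support. *)
Definition bumps p W : set CS := [set h |
  [/\ forall s, modulus (h s) <= 1, forall s, ~ W s -> h s = 0
    & \forall s \near p, h s = 0]].

Lemma bumps0 p W : bumps p W 0.
Proof. by split=> [s||]//; [rewrite modulus0 ler01|exact: nearW]. Qed.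

Lemma bumps_subset p W W' : W `<=` W' -> bumps p W `<=` bumps p W'.
Proof. by move=> WW' h [h1 hW hp]; split=> // s W's; apply: hW => /WW'. Qed.

Lemma bumps_rnorm_le p W h : bumps p W h -> rnorm h <= 1.
Proof. by case=> h1 _ _; apply: Cspace_rnorm_le. Qed.

(** At each point at most one of [h] and [c *: k] is nonzero, so the bound 1 survives. *)
Lemma bumps_add p W W' h k (c : R[i]) :
  bumps p W h -> W' `<=` W -> (forall s, W' s -> h s = 0) ->
  bumps p W' k -> modulus c = 1 -> bumps p W (h + c *: k).
Proof.
move=> [h1 hW hp] W'W hW' [k1 kW' kp] c1; split=> [s|s Ws|].
- have [W's|W's] := pselect (W' s).
    by rewrite Cspace_addE Cspace_scaleE hW'// add0r modulusM c1 mul1r.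
  by rewrite Cspace_addE Cspace_scaleE kW'// scaler0 addr0.
- by rewrite Cspace_addE Cspace_scaleE hW// kW' ?scaler0 ?addr0// => /W'W.
- by apply: filterS2 hp kp => s hs ks; rewrite Cspace_addE Cspace_scaleE hs ks scaler0 addr0.
Qed.

(* Otherwise rotated sums of disjointly supported bumps make [l] unbounded. *)
Lemma small_on_bumps (l : {linear CS -> R[i]^o}) (M e : R) p :
  (forall h, rnorm h <= 1 -> modulus (l h) <= M) -> 0 < e ->
  exists2 W, nbhs p W & forall h, bumps p W h -> modulus (l h) <= e.
Proof.
move=> lM e0; apply: contrapT => noW.
(* Quantifying over all [W] lets the induction pass to the part of [W] where the new bump [h]
   vanishes. *)
have big n : forall W, nbhs p W -> exists2 h, bumps p W h & n%:R * e <= modulus (l h).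
  elim: n => [|n IHn] W pW; first by exists 0; [exact: bumps0|rewrite mul0r rnorm_ge0].
  have [h Wh eh] : exists2 h, bumps p W h & e < modulus (l h).
    apply: contrapT => noh; apply: noW; exists W => // h Wh.
    by rewrite leNgt; apply/negP => eh; apply: noh; exists h.
  have [_ _ hp] := Wh.
  have [k [k1 kW kp] nk] := IHn _ (filterI pW hp).
  have [c c1 lhk] := modulus_align (l h) (l k).
  exists (h + c *: k).
    by apply: (@bumps_add p W (W `&` [set s | h s = 0])) => // s [].
  by rewrite linearD linearZ/= lhk -natr1 mulrDl mul1r addrC lerD// ltW.
have [n Mn] : exists n : nat, M < n%:R * e.
  exists (Num.truncn (M / e)).+1; rewrite -ltr_pdivrMr//.
  by rewrite truncnS_gt.
have [h Wh nh] := big n setT filterT.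
by have := lM h (bumps_rnorm_le Wh); rewrite leNgt (lt_le_trans Mn nh).
Qed.

(** If no [W] works, humps are piled up towards [p] so that the images of the partial sums are large
    at the points already chosen and small at those chosen later, against
    [weakly_compact_double_limit]. *)
Lemma weakly_compact_small_on_bumps (T : {linear CS -> CS}) p (e : R) :
  bounded_op T -> weakly_compact T -> 0 < e ->
  exists2 W, nbhs p W & forall h s, bumps p W h -> modulus (T h s) <= e.
Proof.
move=> [M TM] wT e0; apply: contrapT => noW.
(* The final lower and upper bounds are [e - 3 * d] and [2 * d], which clash once [5 * d < e]. *)
pose d := e / 6; have d0 : 0 < d by rewrite divr_gt0.
have small s : exists2 W, nbhs p W & forall h, bumps p W h -> modulus (T h s) <= d.
  apply: (@small_on_bumps (point_eval s \o T) `|M|) => // h h1.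
  apply: le_trans (rnorm_eval_le (T h) s) _; apply: le_trans (TM h) _.
  apply: le_trans (ler_wpM2r (rnorm_ge0 h) (ler_norm M)) _.
  by rewrite ler_piMr.
pose E W := [set s | exists2 h, bumps p W h & e < modulus (T h s)].
have E0 W : nbhs p W -> E W !=set0.
  move=> pW; apply: contrapT => EW0; apply: noW; exists W => // h s Wh.
  by rewrite leNgt; apply/negP => eh; apply: EW0; exists s; exists h.
(* The sets [E W] form a filter base as [W] shrinks to [p]; [x] is a cluster point of it. *)
have [x xE] : exists x : S, forall N W : set S, nbhs x N -> nbhs p W -> (E W `&` N) !=set0.
  have EF : ProperFilter (filter_from (nbhs p) E).
    apply: filter_from_proper => //; apply: filter_from_filter.
      by exists setT; exact: filterT.
    move=> W W' pW pW'; exists (W `&` W'); first exact: filterI.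
    by move=> s [h Wh eh]; split; exists h => //; apply: bumps_subset Wh => ? [].
  have [|x [_ xE]] := @cS (filter_from (nbhs p) E) EF _.
    by exists setT => //; exact: filterT.
  by exists x => N W xN pW; apply: xE => //; exists W.
(* All partial sums will be bumps in [W1], so their images are at most [d] at [x] and below [2 * d]
   near [x]. *)
have [W1 pW1 small1] := small x.
(* In a state, [W] is where the next hump must live, [N] a neighbourhood of [x] where the image of
   the partial sum [g] is small, and the last entry the point picked last. *)
pose inv (a : set S * set S * CS * S) :=
  let: (W, N, g, _) := a in
  [/\ nbhs p W /\ W `<=` W1, nbhs x N, bumps p W1 g, (forall s, W s -> g s = 0)
    & forall s, N s -> modulus (T g s) < 2 * d].
(* A step adds a hump whose image is large at a point of the old [N], then shrinks [W] so that later
   humps have image at most [d] at that point. *)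
pose step (a b : {a | inv a}) :=
  let: (W, N, g, _) := sval a in let: (W', N', g', s') := sval b in
  [/\ W' `<=` W /\ N' `<=` N, N s', e < modulus (T (g' - g) s'),
      bumps p W (g' - g) /\ (forall s, W' s -> (g' - g) s = 0)
    & forall h, bumps p W' h -> modulus (T h s') <= d].
have inv0 : inv (W1, setT, 0, x).
  split; [by split=> // z|exact: filterT|exact: bumps0|by []|].
  by move=> s _; rewrite linear0 modulus0 mulr_gt0.
have next a : {b | step a b}.
  case: a => -[[[W N] g] s] /= [[pW WW1] xN W1g gW Ng].
  apply: cid; have [s' [[h Wh eh] Ns']] := xE _ _ xN pW.
  have [W2 pW2 small2] := small s'.
  have [_ _ hp] := Wh.
  have W1gh : bumps p W1 (g + h).
    by rewrite -[h]scale1r; apply: (bumps_add W1g WW1) => //; rewrite modulus1.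
  pose N' := N `&` [set s | modulus (T (g + h) s) < 2 * d].
  pose W' := (W `&` [set s | h s = 0]) `&` W2.
  have invb : inv (W', N', g + h, s').
    split=> //.
    - by split; [do 2?apply: filterI|move=> ? [[/WW1]]].
    - apply: filterI => //.
      apply: filterS (nbhs_rnorm_lt (T (g + h)) x d0) => z /=.
      have := small1 _ W1gh; have := rnorm_dist (T (g + h) z : R[i]^o) (T (g + h) x).
      by rewrite ler_norml => /andP[? ?]; lra.
    - by move=> z [[/gW gz hz] _]; rewrite Cspace_addE gz hz addr0.
    - by move=> z [].
  have ghg : g + h - g = h by rewrite addrC addKr.
  exists (exist _ _ invb); rewrite /step/=; split.
  - by split=> z [] // [].
  - by [].
  - by rewrite ghg.
  - by split=> [|z [[_ hz] _]]; [rewrite ghg|rewrite [RHS](esym hz) -[in RHS]ghg].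
  - by move=> k Wk; apply: small2; apply: bumps_subset Wk => ? [].
have [u [_ uS]] := dependent_choice next (exist _ _ inv0).
pose W n := (sval (u n)).1.1.1; pose N n := (sval (u n)).1.1.2.
pose g n := (sval (u n)).1.2; pose y n := (sval (u n)).2.
have uI n : [/\ nbhs p (W n) /\ W n `<=` W1, nbhs x (N n), bumps p W1 (g n),
    (forall s, W n s -> g n s = 0) & forall s, N n s -> modulus (T (g n) s) < 2 * d].
  by rewrite /W /N /g; case: (u n) => -[[[]]].
have {}uS n : [/\ W n.+1 `<=` W n /\ N n.+1 `<=` N n, N n (y n.+1),
    e < modulus (T (g n.+1 - g n) (y n.+1)),
    bumps p (W n) (g n.+1 - g n) /\ (forall s, W n.+1 s -> (g n.+1 - g n) s = 0)
  & forall h, bumps p (W n.+1) h -> modulus (T h (y n.+1)) <= d].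
  have := uS n; rewrite /step /W /N /g /y.
  by case: (u n) => -[[[? ?] ?] ?] ?; case: (u n.+1) => -[[[? ?] ?] ?].
have Ndec m n : (m <= n)%N -> N n `<=` N m.
  move=> /subnKC <-; elim: (n - m)%N => [|k IHk]; first by rewrite addn0.
  by rewrite addnS; have [[_ NS] _ _ _ _] := uS (m + k)%N; exact: subset_trans NS IHk.
(* The humps added after stage [m] have disjoint supports, so their sum is again a single bump in
   [W m]. *)
have tail m n : (m <= n)%N ->
    [/\ W n `<=` W m, bumps p (W m) (g n - g m) & forall s, W n s -> (g n - g m) s = 0].
  move=> /subnKC <-; elim: (n - m)%N => [|k [WW Wg g0]].
    by rewrite addn0 subrr; split=> //; exact: bumps0.
  have [[WS _] _ _ [Wg' g0'] _] := uS (m + k)%N.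
  rewrite addnS -(subrKA (g (m + k)%N)) addrC; split.
  - exact: subset_trans WS WW.
  - by rewrite -[g _.+1 - _]scale1r; apply: (bumps_add Wg WW g0) => //; rewrite modulus1.
  - by move=> s Ws; rewrite Cspace_addE g0' ?addr0 ?g0//; exact: WS.
suff : e - 3 * d <= 2 * d by rewrite /d; lra.
apply: (@weakly_compact_double_limit _ _ _ T (fun n => g n.+1) (fun n => y n.+1)) => //.
- by move=> n; have [_ _ W1g _ _] := uI n.+1; exact: bumps_rnorm_le W1g.
(* Split [g n.+1] into [g j], the next hump and the later ones: at [y j.+1] their images are below
   [2 * d], above [e] and at most [d]. *)
- move=> j n jn; have [_ Ny ey _ smally] := uS j.
  have [_ Wg _] := tail _ _ (jn : (j.+1 <= n.+1)%N).
  have [_ _ _ _ /(_ _ Ny) gy] := uI j.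
  have := smally _ Wg; move: ey gy.
  rewrite !linearB/= !Cspace_addE !Cspace_oppE.
  move: (T (g n.+1) _) (T (g j.+1) _) (T (g j) _) => a b c bc cd ab.
  have := rnorm_dist (b - c : R[i]^o) b; have := rnorm_dist (a : R[i]^o) b.
  rewrite [b - c - b]addrAC subrr add0r.
  have -> : modulus (- c) = modulus c by rewrite /rnorm normrN.
  by rewrite !ler_norml => /andP[? ?] /andP[? ?]; lra.
- move=> j n nj; have [_ Ny _ _ _] := uS j; have [_ _ _ _ Ng] := uI n.+1.
  by apply/ltW/Ng/(Ndec _ _ nj).
Qed.

End bumps.

(** * Urysohn functions, fibres of Daugavet centers and local changes of a function *)

Section interpolation.
Context {R : realType} {S : topologicalType} {cS : compact [set: S]}.
Context (hS : hausdorff_space S).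
Local Notation CS := (Cspace R cS).
Implicit Types (f g h : CS) (s p : S) (U V W : set S).

Lemma continuous_real_complex (u : S -> R) :
  continuous u -> continuous (fun s => (u s)%:C : R[i]^o).
Proof.
move=> cu s; apply: cvg_complexP => /=; first exact: cu.
exact: cvg_cst.
Qed.

Definition rescale (u : S -> R) (cu : continuous u) f : CS :=
  mkcts (fun s => cvgM (@continuous_real_complex u cu s) (@cts_fun _ _ f s))
    : continuousType S R[i]^o.

Lemma bump_exists p V : nbhs p V -> exists u : S -> R,
  [/\ continuous u, u p = 1, forall s, ~ V s -> u s = 0 & forall s, 0 <= u s <= 1].
Proof.
rewrite nbhsE => -[U [oU Up] UV].
have := @urysohn_ext_itv S R (compact_normal hS cS) (~` U) [set p] 0 1.
case=> //.
- exact: open_closedC.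
- exact/accessible_closed_set1/hausdorff_accessible.
- by rewrite setIC; apply/disjoints_subset => _ ->; apply.
move=> u [cu u0 u1 u01]; exists u; split=> //.
- by apply: u1; exists p.
- by move=> s Vs; apply: u0; exists s => // /UV.
- by move=> s; have := u01 _ (imageT u s); rewrite /= in_itv.
Qed.

Lemma modulus_convex (x : R) (z w : R[i]) : 0 <= x <= 1 ->
  modulus z <= 1 -> modulus w <= 1 ->
  modulus (x%:C * z + (1 - x)%:C * w) <= 1.
Proof.
move=> /andP[x0 x1] z1 w1; apply: le_trans (@rnormD R R[i]^o _ _) _.
rewrite !modulusM !modulus_real ger0_norm// ger0_norm ?subr_ge0//.
by nra.
Qed.

(* Otherwise the rank-one operator [f |-> - f p *: g], with [g] a bump in [U],
   cancels the value of [comp_op phi] at the peak of [g]. *)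
Lemma daugavet_center_fiber (phi : continuousType S S) p U :
  daugavet_center (comp_op R cS phi) -> open U -> U !=set0 ->
  exists2 s, U s & phi s <> p.
Proof.
move=> [_ Dphi] oU [s0 Us0]; apply: contrapT => noU.
have phiU s : U s -> phi s = p.
  by move=> Us; apply: contrapT => ps; apply: noU; exists s.
have [u [cu us0 u0 u01]] := bump_exists (open_nbhs_nbhs (conj oU Us0)).
pose one : CS := cst 1 : continuousType S R[i]^o.
pose g : CS := rescale cu one.
have gE s : g s = (u s)%:C := mulr1 _.
pose T0 f : CS := - (f p : R[i]) *: g.
have lT : linear T0.
  move=> a f h; rewrite /T0 scalerA -scalerDl; congr (_ *: _).
  by rewrite Cspace_addE Cspace_scaleE opprD mulrN.
pose T := HB.pack_for {linear CS -> CS} T0 (GRing.isLinear.Build R[i] CS CS *:%R T0 lT).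
have TE f s : T f s = - f p * (u s)%:C by rewrite -gE.
have one1 : rnorm one <= 1.
  by apply: Cspace_rnorm_le => // s; rewrite modulus1.
have g1 : rnorm g <= 1.
  apply: Cspace_rnorm_le => // s; rewrite gE modulus_real.
  by have /andP[? ?] := u01 s; rewrite ger0_norm.
have bT : bounded_op T.
  exists 1 => f; rewrite mul1r [T f](_ : _ = T0 f)// rnormZ.
  rewrite -[leRHS]mulr1 ler_pM ?rnorm_ge0//.
  by rewrite [rnorm _](_ : _ = modulus (f p)) ?rnorm_eval_le// /rnorm normrN.
have rT : rank_one T.
  exists g.
    apply/eqP => /(congr1 (fun f : CS => f s0)); rewrite gE us0 => /eqP.
    by rewrite (oner_eq0 R[i]).
  apply/seteqP; split=> _ [x _ <-]; first by exists (- x p).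
  exists (- x *: one) => //; rewrite [T _](_ : _ = T0 (- x *: one))// /T0.
  by rewrite Cspace_scaleE; congr (_ *: g); rewrite [_ *: _]mulr1 opprK.
(* The bound 2 makes the supremum finite; both operators are tested on [one], at the point [s0]. *)
have le_opnorm (F : CS -> CS) : (forall f, rnorm f <= 1 -> rnorm (F f) <= 2) ->
    1 <= rnorm (F one) -> 1 <= opnorm F.
  move=> F2 F1; apply: le_trans F1 _; apply: ub_le_sup.
    by exists 2 => _ [f + <-]; rewrite closed_unit_ballE; exact: F2.
  by exists one => //; rewrite closed_unit_ballE.
(* The sum has value [(1 - u s) * f p] on [U] and [f (phi s)] off [U], whereas the Daugavet equation
   makes its norm at least 2. *)
have : opnorm (fun f => comp_op R cS phi f + T f) <= 1.
  apply: ge_sup.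
    exists (rnorm (comp_op R cS phi one + T one)), one => //.
    by rewrite closed_unit_ballE.
  move=> _ [f + <-]; rewrite closed_unit_ballE => f1.
  have f1' s : modulus (f s) <= 1 := le_trans (rnorm_eval_le f s) f1.
  apply: Cspace_rnorm_le => // s; rewrite Cspace_addE TE.
  have [Us|/u0 ->] := pselect (U s); last by rewrite mulr0 addr0; exact: f1'.
  rewrite [comp_op _ _ _ _ _](_ : _ = f p) ?/comp_op/= ?phiU//.
  have -> : f p + - f p * (u s)%:C = (1 - (u s))%:C * (f p : R[i]) by rewrite rmorphB/=; ring.
  rewrite modulusM modulus_real; have /andP[u_ge0 u_le1] := u01 s.
  by rewrite ger0_norm ?subr_ge0// mulr_ile1 ?subr_ge0 ?rnorm_ge0// lerBlDr lerDl.
rewrite Dphi//; apply/negP; rewrite -ltNge.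
have C1 : 1 <= opnorm (comp_op R cS phi).
  apply: le_opnorm => [f f1|].
    apply: Cspace_rnorm_le => // s; apply: le_trans (rnorm_eval_le f _) _.
    by apply: le_trans f1 _; rewrite ler1n.
  by apply: le_trans (rnorm_eval_le _ s0); rewrite /comp_op/= modulus1.
have T1 : 1 <= opnorm T.
  apply: le_opnorm => [f f1|].
    apply: Cspace_rnorm_le => // s; rewrite TE modulusM modulus_real.
    rewrite [modulus (- _)](_ : _ = modulus (f p)); last by rewrite /rnorm normrN.
    have := le_trans (rnorm_eval_le f p) f1; have /andP[? ?] := u01 s.
    rewrite ger0_norm// => ?; have := rnorm_ge0 (f p : R[i]^o); nra.
  apply: le_trans (rnorm_eval_le _ s0); rewrite TE us0 mulr1 /=.
  by rewrite /rnorm normrN normr1.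
by lra.
Qed.

(** Unlike in [bumps], [h] may be nonzero at [p], so a value can be prescribed there. *)
Definition negligible_near (T : {linear CS -> CS}) (e : R) p :=
  exists2 V, nbhs p V & forall h, rnorm h <= 1 -> (forall s, ~ V s -> h s = 0) ->
    forall s, modulus (T h s) <= e.

(** Take [W] for the bumps at [phi s0]. The points of [U] that [phi] sends into the interior of [W]
    but not to [phi s0] form a nonempty open set, and a function supported close enough to such a
    [phi s] vanishes near [phi s0], hence is a bump. *)
Lemma negligible_near_dense (T : {linear CS -> CS}) (phi : continuousType S S)
    (e : R) U :
  bounded_op T -> weakly_compact T -> 0 < e ->
  daugavet_center (comp_op R cS phi) -> open U -> U !=set0 ->
  exists V, [/\ open V, V !=set0, V `<=` U &
    forall s, V s -> negligible_near T e (phi s)].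
Proof.
move=> bT wT e0 Dphi oU [s0 Us0].
have [W + Wsmall] := weakly_compact_small_on_bumps (phi s0) bT wT e0.
rewrite nbhsE => -[W' [oW' W's0] W'W].
have cphi W'' : open W'' -> open (phi @^-1` W'').
  by move=> oW''; apply: open_comp => // s _; exact: cts_fun.
pose U' := U `&` phi @^-1` W'.
have oU' : open U' by apply: openI => //; exact: cphi.
have [s1 U's1 s01] := daugavet_center_fiber (phi s0) Dphi oU' (ex_intro _ s0 (conj Us0 W's0)).
exists (U' `&` phi @^-1` (~` [set phi s0])); split.
- apply: openI => //; apply: cphi; apply: closed_openC.
  exact/accessible_closed_set1/hausdorff_accessible.
- by exists s1.
- by move=> s [[]].
move=> s [[Us W's] /= ps].
move: (hS); rewrite open_hausdorff => /(_ (phi s) (phi s0)) [|[A B] /=]; first exact/eqP.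
move=> [/set_mem As /set_mem Bs] [oA oB AB].
exists (W' `&` A); first by apply: open_nbhs_nbhs; split; [exact: openI|].
move=> h h1 hV s'; apply: Wsmall; split.
- by move=> x; apply: le_trans (rnorm_eval_le h x) h1.
- by move=> x Wx; apply: hV => -[/W'W].
- apply: filterS (open_nbhs_nbhs (conj oB Bs)) => x Bx; apply: hV => -[_ Ax].
  by move/eqP : AB => /seteqP[/(_ x)+ _]; apply.
Qed.

(** With a Urysohn function [u] at [p], [f + u * (c - f)] is a pointwise convex combination of [f]
    and [c]. It keeps the value [c] wherever [f] has it, so a second change does not undo the
    first. *)
Lemma negligible_near_interpolate (T : {linear CS -> CS}) (e : R) p f (c : R[i]) :
  negligible_near T e p -> rnorm f <= 1 -> modulus c = 1 ->
  exists f', [/\ rnorm f' <= 1, f' p = c, forall s, f s = c -> f' s = c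
    & forall s, modulus (T f' s - T f s) <= 2 * e].
Proof.
move=> [V pV Vsmall] f1 c1; have [u [cu up u0 u01]] := bump_exists pV.
pose cc : CS := cst c : continuousType S R[i]^o.
pose h : CS := rescale cu (cc - f).
have hE s : h s = (u s)%:C * (c - f s) by [].
have fs s : modulus (f s) <= 1 := le_trans (rnorm_eval_le f s) f1.
exists (f + h); split.
- apply: Cspace_rnorm_le => // s; rewrite Cspace_addE hE.
  have -> : f s + (u s)%:C * (c - f s) = (u s)%:C * c + (1 - u s)%:C * (f s : R[i]).
    by rewrite rmorphB/=; ring.
  by apply: modulus_convex; rewrite ?c1.
- by rewrite Cspace_addE hE up mul1r addrC subrK.
- by move=> s fsc; rewrite Cspace_addE hE fsc subrr mulr0 addr0.
move=> s; rewrite linearD Cspace_addE addrAC subrr add0r.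
(* As [c - f s] can have modulus 2, [h] is halved to enter the unit ball; hence the factor in
   [2 * e]. *)
pose k : CS := (2^-1)%:C *: h.
have -> : h = 2%:C *: k.
  by rewrite scalerA -rmorphM/= divff ?scale1r// pnatr_eq0.
rewrite linearZ/= Cspace_scaleE rnormZ modulus_real ger0_norm// ler_wpM2l//.
apply: Vsmall => [|x Vx].
  apply: Cspace_rnorm_le => // x; rewrite Cspace_scaleE hE rnormZ modulus_real modulusM modulus_real.
  have := rnormD (c : R[i]^o) (- f x); have /andP[? ?] := u01 x; have := fs x.
  rewrite c1 [modulus (- _)](_ : _ = modulus (f x)); last by rewrite /rnorm normrN.
  move=> ? ?; rewrite !ger0_norm// ?invr_ge0//.
  have := rnorm_ge0 (c - f x : R[i]^o); nra.
by rewrite Cspace_scaleE hE u0// mul0r scaler0.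
Qed.

End interpolation.

(** * The operator norm as a genuine supremum, not a default value of [sup] *)

Section opnorm_theory.
Context {R : realType} {X Y : completeNormedModType R[i]}.

Lemma opnorm_has_sup (T : {linear X -> Y}) : bounded_op T ->
  has_sup [set rnorm (T x) | x in closed_unit_ball X].
Proof.
move=> [M TM]; split.
  by exists (rnorm (T 0)), 0 => //; rewrite /closed_unit_ball/= normr0 ler01.
exists `|M| => _ [x /= x1 <-]; apply: le_trans (TM x) _.
apply: le_trans (ler_wpM2r (rnorm_ge0 x) (ler_norm M)) _.
by rewrite ler_piMr// -lecR rnormE.
Qed.

End opnorm_theory.

(** * The norm of the perturbed convex combination *)

Unset Implicit Arguments.

Theorem theorem2p12 (R : realType) (S : topologicalType)
    (cS : compact [set: S]) (hS : hausdorff_space S)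
    (iS : isolated [set: S] = set0)
    (phi psi : continuousType S S) (phi_psi : phi <> psi)
    (Dphi : daugavet_center (comp_op R cS phi))
    (Dpsi : daugavet_center (comp_op R cS psi))
    (T : {linear Cspace R cS -> Cspace R cS})
    (bT : bounded_op T) (wT : weakly_compact T)
    (t : R) (t01 : 0 <= t <= 1) :
  opnorm (fun f : Cspace R cS =>
    t%:C *: comp_op R cS phi f + (1 - t)%:C *: comp_op R cS psi f + T f) =
  1 + opnorm T.
Proof.
set F := (F in opnorm F = _).
have supT := opnorm_has_sup bT; have [T0 ubT] := supT.
have FE f s : F f s = t%:C * f (phi s) + (1 - t)%:C * f (psi s) + T f s by [].
have F_le f : closed_unit_ball _ f -> rnorm (F f) <= 1 + opnorm T.
  move=> f1; have Tf1 : rnorm (T f) <= opnorm T by apply: ub_le_sup => //; exists f.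
  move: f1; rewrite closed_unit_ballE => f1.
  have f1' s : modulus (f s) <= 1 := le_trans (rnorm_eval_le f s) f1.
  have T_ge0 : 0 <= opnorm T := le_trans (rnorm_ge0 _) Tf1.
  apply: Cspace_rnorm_le => [|s]; first by rewrite addr_ge0.
  rewrite FE; apply: le_trans (@rnormD R R[i]^o _ _) _; apply: lerD.
    exact: modulus_convex.
  exact: le_trans (rnorm_eval_le _ s) Tf1.
have ubF : has_ubound [set rnorm (F f) | f in closed_unit_ball (Cspace R cS)].
  by exists (1 + opnorm T) => _ [f f1 <-]; exact: F_le.
apply/eqP; rewrite eq_le; apply/andP; split.
  apply: ge_sup => [|_ [f f1 <-]]; last exact: F_le.
  by exists (rnorm (F 0)), 0 => //; rewrite closed_unit_ballE /rnorm normr0 ler01.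
(* The losses are [d] for the near-maximality of [T f] and [2 * d] for each of the two changes of
   [f], in all [5 * d < e]. *)
apply/ler_addgt0Pr => e e0; pose d := e / 6.
have d0 : 0 < d by rewrite divr_gt0.
have [_ [f + <-] Tf] := sup_adherent d0 supT; rewrite closed_unit_ballE => f1.
have [s0 Tfs0] : exists s, opnorm T - d < modulus (T f s).
  (* A point is needed to see that [opnorm T - d] is nonnegative; on an empty [S] the maps [phi] and
     [psi] would coincide. *)
  apply: contrapT => nos; have [s1] : exists s : S, True.
    by apply: contrapT => noS; apply: phi_psi; apply/continuousEP => s; case: noS; exists s.
  move=> _; have le_s s : modulus (T f s) <= opnorm T - d.
    by rewrite leNgt; apply/negP => ?; apply: nos; exists s.
  move: Tf; apply/negP; rewrite -leNgt; apply: Cspace_rnorm_le => //.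
  exact: le_trans (rnorm_ge0 _) (le_s s1).
pose U := [set s | opnorm T - d < modulus (T f s)].
have oU : open U.
  apply: (@open_comp _ _ (fun s => modulus (T f s)) [set x | opnorm T - d < x]); last exact: open_gt.
  move=> s _; apply: continuous_comp; first exact: cts_fun.
  exact: rnorm_continuous.
(* Shrinking [U] twice yields [s] such that [T] is negligible near both [phi s] and [psi s]. *)
have [V [oV V0 VU Vphi]] := negligible_near_dense hS bT wT d0 Dphi oU (ex_intro _ s0 Tfs0).
have [W [_ [s Ws] WV Wpsi]] := negligible_near_dense hS bT wT d0 Dpsi oV V0.
(* Once the function equals this phase [c] at [phi s] and [psi s], the convex combination is [c] for
   every [t] and is aligned with [T f s]. *)
have [c c1 Tfs] := modulus_polar (T f s).
have [f' [f'1 f'phi _ f'T]] := negligible_near_interpolate hS (Vphi _ (WV _ Ws)) f1 c1.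
have [f'' [f''1 f''psi /(_ _ f'phi) f''phi f''T]] :=
  negligible_near_interpolate hS (Wpsi _ Ws) f'1 c1.
have Ff'' : rnorm (F f'') <= opnorm F.
  by apply: ub_le_sup => //; exists f'' => //; rewrite closed_unit_ballE.
apply: (@le_trans _ _ (modulus (F f'' s) + e)); last first.
  by rewrite lerD2r; apply: le_trans Ff''; exact: rnorm_eval_le.
rewrite FE f''phi f''psi -mulrDl -rmorphD/= [t + _]addrC subrK mul1r.
have : modulus (c + T f s) = 1 + modulus (T f s).
  rewrite {1}Tfs -{1}[c]mul1r -mulrDl -(rmorphD _ 1)/= modulusM c1 mulr1 modulus_real.
  by rewrite ger0_norm// addr_ge0// rnorm_ge0.
have := rnorm_dist (c + T f s : R[i]^o) (c + T f'' s).
rewrite opprD addrACA subrr add0r rnormB.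
have := rnormD (T f'' s - T f' s : R[i]^o) (T f' s - T f s); rewrite subrKA.
have := f'T s; have := f''T s; have := VU _ (WV _ Ws).
rewrite /U /= ler_norml => ? ? ? ? /andP[? ?] ?.
have : e = 6 * d by rewrite /d; lra.
by lra.
Qed.
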